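(* Let $n\ge 2$ be an integer and let $r,v\in\mathbb{R}$ satisfy $r>1$ and $0<v<1$. Put $\alpha_3=1$ and $\alpha_4=-1$. For $i\in\{3,4\}$ let $\mathbf{A}_i\in\mathbb{R}^{n\times n}$ be the matrix whose $(1,1)$ entry is $r$, whose $(1,2)$ entry is $\alpha_i v$, whose $(j,j+1)$ entry is $v$ for $2\le j\le n-1$, and whose other entries are all zero, and let $\mathbf{B}=(0,\dots,0,v)^\top\in\mathbb{R}^n$. Then the pair of single-input systems $S_3=(\mathbf{A}_3,\mathbf{B})$ and $S_4=(\mathbf{A}_4,\mathbf{B})$ is not co-stabilizable by any linear dynamic state feedback controller (of any order $p\ge 0$).
   Context: A system $(\mathbf{A},\mathbf{B})$ with $\mathbf{A}\in\mathbb{R}^{n\times n}$, $\mathbf{B}\in\mathbb{R}^{n\times m}$ denotes the fully observed discrete-time linear time-invariant system $\mathbf{x}_{t+1}=\mathbf{A}\mathbf{x}_t+\mathbf{B}\mathbf{u}_t$; here $m=1$. $\rho(\cdot)$ denotes the spectral radius of a real square matrix. Linear dynamic state feedback: $\mathbf{z}_{t+1}=\mathbf{F}\mathbf{z}_t+\mathbf{G}\mathbf{x}_t$, $\mathbf{u}_t=\mathbf{H}\mathbf{z}_t+\mathbf{K}\mathbf{x}_t$, where $\mathbf{z}_t\in\mathbb{R}^p$, $\mathbf{F}\in\mathbb{R}^{p\times p}$, $\mathbf{G}\in\mathbb{R}^{p\times n}$, $\mathbf{H}\in\mathbb{R}^{m\times p}$, $\mathbf{K}\in\mathbb{R}^{m\times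 n}$. A pair of systems $(\mathbf{A}_i,\mathbf{B}_i)$, with $i$ ranging over two indices, is co-stabilizable by linear dynamic state feedback if there exist an integer $p\ge 0$ and real matrices $(\mathbf{K},\mathbf{H},\mathbf{G},\mathbf{F})$ of these sizes (the same for both systems) such that $\rho\!\left(\begin{bmatrix}\mathbf{A}_i+\mathbf{B}_i\mathbf{K} & \mathbf{B}_i\mathbf{H}\\ \mathbf{G}&\mathbf{F}\end{bmatrix}\right)<1$ for both $i$. *)

(* Defs.v *)
From mathcomp Require Import all_boot all_order all_algebra.
From mathcomp Require Import complex.
From mathcomp Require Import classical_sets reals.

Set Implicit Arguments.
Unset Strict Implicit.
Unset Printing Implicit Defensive.

Import Order.TTheory GRing.Theory Num.Theory.
Import Normc.

Local Open Scope ring_scope.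
Local Open Scope classical_set_scope.

(* The eigenvalues are the complex ones: the real matrix is embedded in R[i],
   where normc is the R-valued modulus. The set is finite, so the supremum is a
   maximum; for the empty matrix (k = 0) it is sup set0 = 0. *)
Definition spectral_radius (R : realType) (k : nat) (M : 'M[R]_k) : R :=
  sup [set normc l | l in
        [set l : R[i] | eigenvalue (map_mx (real_complex R) M) l]].

Definition closed_loop (R : realType) (n m p : nat)
    (A : 'M[R]_n) (B : 'M[R]_(n, m))
    (K : 'M[R]_(m, n)) (H : 'M[R]_(m, p)) (G : 'M[R]_(p, n)) (F : 'M[R]_p) :
    'M[R]_(n + p) :=
  block_mx (A + B *m K) (B *m H) G F.

(* One and the same controller, of some order p (possibly 0), for both
   systems. *)
Definition co_stabilizable (R : realType) (n m : nat)
    (A1 : 'M[R]_n) (B1 : 'M[R]_(n, m))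
    (A2 : 'M[R]_n) (B2 : 'M[R]_(n, m)) : Prop :=
  exists (p : nat) (K : 'M[R]_(m, n)) (H : 'M[R]_(m, p))
         (G : 'M[R]_(p, n)) (F : 'M[R]_p),
    spectral_radius (closed_loop A1 B1 K H G F) < 1 /\
    spectral_radius (closed_loop A2 B2 K H G F) < 1.

(* Indices are 0-based: the (1,1) and (1,2) entries are (0,0) and (0,1), and
   the remaining superdiagonal entries (j, j+1) are those with row j >= 1. *)
Definition chainA (R : realType) (n : nat) (r v alpha : R) : 'M[R]_n :=
  \matrix_(i < n, j < n)
    if (i == 0 :> nat) && (j == 0 :> nat) then r
    else if (i == 0 :> nat) && (j == 1 :> nat) then alpha * v
    else if (0 < i)%N && (j == i.+1 :> nat) then v
    else 0.

Definition chainB (R : realType) (n : nat) (v : R) : 'M[R]_(n, 1) :=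
  \col_(i < n) if i.+1 == n then v else 0.

(* Main.v *)
Require Import Defs.
From mathcomp Require Import all_boot all_order all_algebra reals.
From mathcomp Require Import complex polyrcf.

Import Order.TTheory GRing.Theory Num.Theory.

Local Open Scope ring_scope.

(** The two closed loops differ only in the sign of the (1,2) entry. At s = r
    the (1,1) entry of sI - M vanishes, so the first rows of the two matrices
    rI - M are opposite while all other rows agree: the two characteristic
    polynomials take opposite values at r. But a monic real polynomial whose
    roots all lie in the open unit disc is positive at every real s >= 1. *)

(** Without roots on [[a, +oo[], the sign at [a] is the sign at infinity, which is that of the
    leading coefficient 1. *)
Lemma monic_gt0_noroot (R : rcfType) (p : {poly R}) (a : R) :
  p \is monic -> (forall x, a <= x -> ~~ root p x) -> 0 < p.[a].
Proof.
move=> /monicP lp1 nroot.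
have a_in : a \in `[a, +oo[%R by rewrite in_itv /= lexx.
rewrite -sgr_gt0 (sgp_pinftyP (x := a)) // => [|x].
  by rewrite /sgp_pinfty lp1 sgr1 ltr01.
by rewrite in_itv /= andbT; apply: nroot.
Qed.

Lemma normc_le_spectral_radius (R : realType) (k : nat) (M : 'M[R]_k)
    (l : R[i]) :
  eigenvalue (map_mx (real_complex R) M) l ->
  Normc.normc l <= spectral_radius M.
Proof.
move=> eig_l; apply: ub_le_sup; last by exists l.
set P := char_poly (map_mx (real_complex R) M).
have [s def_P] := closed_field_poly_normal P.
(* A supremum dominates its members only once the set is known to be bounded: the sum of the moduli
   of all roots of [P] bounds each of them. *)
exists (\sum_(z <- s) Normc.normc z) => _ [z /= eig_z <-].
have nneg (w : R[i]) : 0 <= Normc.normc w by case: w => ? ?; apply: sqrtr_ge0.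
have z_s : z \in s.
  move: eig_z; rewrite eigenvalue_root_char -/P def_P.
  by rewrite (monicP (char_poly_monic _)) scale1r root_prod_XsubC.
rewrite (big_rem z z_s) /= lerDl.
by apply: sumr_ge0.
Qed.

Lemma char_poly_gt0 (R : realType) (k : nat) (M : 'M[R]_k) (a : R) :
  spectral_radius M < 1 -> 1 <= a -> 0 < (char_poly M).[a].
Proof.
move=> rho_lt1 a_ge1; apply: monic_gt0_noroot (char_poly_monic _) _ => x a_le_x.
apply/negP => root_x.
have /normc_le_spectral_radius :
    eigenvalue (map_mx (real_complex R) M) (real_complex R x).
  by rewrite eigenvalue_root_char -map_char_poly fmorph_root.
rewrite /= expr0n /= addr0 sqrtr_sqr => absx_le.
have := le_lt_trans (le_trans (ler_norm x) absx_le) rho_lt1.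
by rewrite ltNge (le_trans a_ge1 a_le_x).
Qed.

Lemma horner_char_poly (R : comNzRingType) (k : nat) (M : 'M[R]_k) (a : R) :
  (char_poly M).[a] = \det (a%:M - M).
Proof.
rewrite -horner_evalE -det_map_mx; congr (\det _).
by apply/matrixP => i j; rewrite !mxE /= horner_evalE !hornerE hornerMn hornerX.
Qed.

Lemma char_poly_opp_row (R : comNzRingType) (k : nat) (M N : 'M[R]_k)
    (i0 : 'I_k) (a : R) :
    row i0 (a%:M - M) = - row i0 (a%:M - N) -> row' i0 M = row' i0 N ->
  (char_poly M).[a] = - (char_poly N).[a].
Proof.
move=> opp_row eq_rows; rewrite !horner_char_poly.
have row'E : row' i0 (a%:M - N) = row' i0 (a%:M - M).
  by rewrite !linearB /= eq_rows.
(* Multilinearity is used only to scale row [i0] by -1; the second summand, with coefficient 0, is a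
   dummy. *)
rewrite (@determinant_multilinear _ _ _ (a%:M - N) (a%:M - N) i0 (-1) 0) //.
  by rewrite mul0r addr0 mulN1r.
by rewrite scale0r addr0 scaleN1r.
Qed.

Theorem theorem4 (R : realType) (n : nat) (r v : R) :
  (2 <= n)%N -> 1 < r -> 0 < v < 1 ->
  ~ co_stabilizable (chainA n r v 1) (chainB n v)
                    (chainA n r v (-1)) (chainB n v).
Proof.
case: n => [|[|n]] // _ r_gt1 _ [p [K [H [G [F [rho1 rho2]]]]]].
have pos1 := char_poly_gt0 _ _ _ _ rho1 (ltW r_gt1).
have pos2 := char_poly_gt0 _ _ _ _ rho2 (ltW r_gt1).
(* The input enters at the last state, which is not the first one since the dimension is at least 2;
   so no feedback reaches row 0 of the loop. *)
have BM0 q (X : 'M[R]_(1, q)) j : (chainB n.+2 v *m X) ord0 j = 0.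
  by rewrite mxE big_ord1 mxE mul0r.
pose loop alpha := closed_loop (chainA n.+2 r v alpha) (chainB n.+2 v) K H G F.
suff E : (char_poly (loop 1)).[r] = - (char_poly (loop (-1))).[r].
  by move: pos1; rewrite -/(loop 1) E oppr_gt0 ltNge (ltW pos2).
apply: (char_poly_opp_row _ _ _ _ (lshift p ord0)).
  have AE alpha (j : 'I_n.+2) : chainA n.+2 r v alpha ord0 j =
      if j == 0%N :> nat then r else if j == 1%N :> nat then alpha * v else 0.
    by rewrite mxE.
  apply/rowP => j; rewrite -(splitK j); case: (split j) => {}j /=.
    rewrite !mxE (unsplitK (inl ord0)) !row_mxEl ![(_ + _ *m _) _ _]mxE.
    rewrite !BM0 !addr0 !AE.
    rewrite (inj_eq (@lshift_inj _ _)) -val_eqE /= eq_sym.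
    (* The choice s = r kills the diagonal entry, the only one that could break the antisymmetry in
       [alpha]; column 1 then holds [- (alpha * v)]. *)
    case: (_ == 0%N :> nat); first by rewrite mulr1n subrr oppr0.
    case: (_ == 1%N :> nat); first by rewrite mulr0n !sub0r mul1r mulN1r opprK.
    by rewrite mulr0n subr0 oppr0.
  rewrite !mxE (unsplitK (inl ord0)) !row_mxEr !BM0.
  by rewrite eq_lrshift subr0 oppr0.
(* Below row 0 the loops coincide, since [alpha] occurs in row 0 only. *)
apply/matrixP => i j; rewrite !mxE; case: splitP => // i' def_i'.
have i'_gt0 : (0 < i')%N by rewrite -def_i'.
rewrite !mxE; case: splitP => // j' _; rewrite ![(_ + _ *m _) _ _]mxE.
by congr (_ + _); rewrite !mxE eqn0Ngt i'_gt0.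
Qed.
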